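(* Let $n\ge 1$ and let $\lambda,\mu,\nu\vdash n$ be partitions with $\ell(\lambda)=\ell$, $\ell(\mu)=m$ and $\ell(\nu)=r$. Then $$g(\lambda,\mu,\nu)\;\le\;\left(1+\frac{\ell m r}{n}\right)^{n}\left(1+\frac{n}{\ell m r}\right)^{\ell m r}.$$
   Context: For a partition $\lambda$, $\ell(\lambda)$ denotes its number of (nonzero) parts. For $\lambda\vdash n$, $\chi^\lambda$ denotes the irreducible character of the symmetric group $S_n$ indexed by $\lambda$. The Kronecker coefficient is $g(\lambda,\mu,\nu)=\frac{1}{n!}\sum_{\sigma\in S_n}\chi^\lambda(\sigma)\chi^\mu(\sigma)\chi^\nu(\sigma)$, equivalently the multiplicity of $\chi^\lambda$ in $\chi^\mu\cdot\chi^\nu$. *)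

(* Defs.v *)
From HB Require Import structures.
From mathcomp Require Import all_boot all_order all_fingroup all_algebra.
From mathcomp Require Import all_solvable all_field all_character.

Set Implicit Arguments.
Unset Strict Implicit.
Unset Printing Implicit Defensive.

Import GRing.Theory.
Local Open Scope ring_scope.

Definition intpart (n : nat) (la : seq nat) : bool :=
  [&& sorted geq la, 0%N \notin la & sumn la == n].

(* The irreducible character of S_n indexed by la is defined as the character
   of the Specht module, the span of the polytabloids in the permutation module
   on tabloids.

   The cells of the Young diagram of la |- n are numbered 0, ..., n - 1 row by
   row, so that cell k lies in row reshape_index la k and in column
   reshape_offset la k.  A tableau of shape la (a bijective filling of the
   diagram by 'I_n) is then a permutation t, with entry t k in cell k.  As
   products of permutations compose from left to right, S_n acts on the right
   on tableaux: t * s is t with every entry x replaced by s x. *)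
Section Specht.

Variables (n : nat) (la : seq nat).
Implicit Types (s t u q : 'S_n) (x : 'I_n).

Definition entry_row t x : nat := reshape_index la (t^-1%g x).
Definition entry_col t x : nat := reshape_offset la (t^-1%g x).

Definition row_class t : {set 'S_n} :=
  [set u | [forall x, entry_row u x == entry_row t x]].

Definition tabloid : finType :=
  {T : {set 'S_n} | T \in [set row_class t | t : 'S_n]}.

Lemma row_class_tabloid t : row_class t \in [set row_class u | u : 'S_n].
Proof. exact: imset_f. Qed.

Definition tabloid_of t : tabloid := exist _ (row_class t) (row_class_tabloid t).

Lemma tabloidP (T : tabloid) : exists t, T = tabloid_of t.
Proof.
by case: T => T TP; have /imsetP[t _ eT] := TP; exists t; apply: val_inj.
Qed.

Lemma entry_rowM t s x : entry_row (t * s) x = entry_row t (s^-1%g x).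
Proof. by rewrite /entry_row invMg permM. Qed.

Lemma entry_colM t s x : entry_col (t * s) x = entry_col t (s^-1%g x).
Proof. by rewrite /entry_col invMg permM. Qed.

Lemma row_classM t s : row_class (t * s) = (row_class t :* s)%g.
Proof.
apply/setP=> u; rewrite mem_rcoset !inE; apply/forallP/forallP=> eu x.
  by have := eu (s x); rewrite !entry_rowM permK invgK.
by have := eu (s^-1%g x); rewrite !entry_rowM invgK permKV.
Qed.

Definition tabloid_mx s : 'M[algC]_#|tabloid| :=
  \matrix_(i, j) (val (enum_val j) == (val (enum_val i) :* s)%g)%:R.

Lemma row_tabloid_mx t s :
  row (enum_rank (tabloid_of t)) (tabloid_mx s) =
    delta_mx 0 (enum_rank (tabloid_of (t * s)%g)).
Proof.
apply/rowP=> j; rewrite !mxE eqxx /= enum_rankK /= -row_classM.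
by rewrite -(inj_eq enum_val_inj) enum_rankK.
Qed.

Lemma tabloid_mxE t s :
  delta_mx 0 (enum_rank (tabloid_of t)) *m tabloid_mx s =
    delta_mx 0 (enum_rank (tabloid_of (t * s)%g)) :> 'rV_#|tabloid|.
Proof. by rewrite -rowE row_tabloid_mx. Qed.

Lemma tabloid_mx_repr : mx_repr [set: 'S_n] tabloid_mx.
Proof.
split=> [|s u _ _]; apply/row_matrixP=> i;
  have [t et] := tabloidP (enum_val i);
  rewrite -(enum_valK i) et row_tabloid_mx.
  by rewrite mulg1 row1.
by rewrite row_mul row_tabloid_mx tabloid_mxE mulgA.
Qed.

Definition tabloid_repr : mx_representation algC [set: 'S_n] #|tabloid| :=
  MxRepresentation tabloid_mx_repr.

Definition col_stab t : {set 'S_n} :=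
  [set q : 'S_n | [forall x, entry_col t (q x) == entry_col t x]].

(* The coefficient (-1) ^+ q is the sign of the permutation q. *)
Definition polytabloid t : 'rV[algC]_#|tabloid| :=
  \sum_(q in col_stab t)
     (-1) ^+ q *: delta_mx 0 (enum_rank (tabloid_of (t * q)%g)).

Definition specht_mx : 'M[algC]_#|tabloid| :=
  (\sum_(t : 'S_n) <<polytabloid t>>)%MS.

Lemma polytabloidM t s : polytabloid t *m tabloid_mx s = polytabloid (t * s).
Proof.
rewrite /polytabloid mulmx_suml [RHS](reindex_inj (conjg_inj s)) /=.
apply: eq_big => [q|q _].
  rewrite !inE; apply/forallP/forallP=> eq x.
    rewrite !entry_colM conjgE !permM permK.
    exact: eq.
  by have := eq (s x); rewrite !entry_colM conjgE !permM !permK.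
by rewrite -scalemxAl tabloid_mxE odd_permJ conjgE -!mulgA mulKVg.
Qed.

Lemma specht_module : mxmodule tabloid_repr specht_mx.
Proof.
apply/mxmoduleP=> s _; rewrite sumsmxMr_gen; apply/sumsmx_subP=> t _.
rewrite genmxE (eqmxMr _ (genmxE _)) /= polytabloidM.
by apply: (sumsmx_sup (t * s)%g); rewrite // genmxE.
Qed.

Definition specht_repr : mx_representation algC [set: 'S_n] (\rank specht_mx) :=
  submod_repr specht_module.

Definition Sn_char : 'CF([set: 'S_n]) := cfRepr specht_repr.

End Specht.

Definition kronecker (n : nat) (la mu nu : seq nat) : algC :=
  (n`!)%:R^-1 *
  \sum_(s : 'S_n) Sn_char n la s * Sn_char n mu s * Sn_char n nu s.

(* Main.v *)
Require Import Defs.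
From mathcomp Require Import all_boot all_order all_fingroup all_algebra.
From mathcomp Require Import all_solvable all_field all_character.
Set Implicit Arguments.
Unset Strict Implicit.
Unset Printing Implicit Defensive.
Import Order.TTheory GRing.Theory Num.Theory.
Local Open Scope ring_scope.

(** The Specht module of [la] is a submodule of the permutation module on
    tabloids, so [kronecker n la mu nu] is at most the multiplicity of the
    trivial character in the product of the three permutation characters.  By
    Burnside's lemma this is the number of orbits of S_n on triples of tabloids.
    Recording the three rows containing each entry embeds these triples into the
    words of length n over an alphabet of l * m * r letters, and each orbit of
    words has a sorted representative.  This gives at most 'C(n + N, n) orbits
    with N = l * m * r, and 'C(n + N, n) * n ^ n * N ^ N is one term of the
    binomial expansion of (n + N) ^ (n + N). *)

Section Words.

Variables (n : nat) (T : finType).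

(** The letter at position [i] moves to position [s i]; the inverse makes this a right action, as
    for tableaux. *)
Definition word_act (t : n.-tuple T) (s : 'S_n) : n.-tuple T :=
  [tuple tnth t (s^-1%g i) | i < n].

Lemma word_act1 t : word_act t 1%g = t.
Proof. by apply: eq_from_tnth => i; rewrite tnth_mktuple invg1 perm1. Qed.

Lemma word_actM t : act_morph word_act t.
Proof.
by move=> s u; apply: eq_from_tnth => i; rewrite !tnth_mktuple invMg permM.
Qed.

Definition word_action := TotalAction word_act1 word_actM.

End Words.

Lemma card_word_orbits n N :
  (#|[set orbit (word_action n 'I_N.+1) [set: 'S_n] t | t in setT]|
    <= 'C(n + N, n))%N.
Proof.
rewrite -card_sorted_tuples.
set S := [set t : n.-tuple 'I_N.+1 | _].
apply: leq_trans (leq_imset_card (orbit (word_action n 'I_N.+1) setT) S).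
apply/subset_leq_card/subsetP => _ /imsetP[t _ ->].
pose t' := [tuple of sort (relpre val leq) t].
have /tuple_permP[p Ep] : perm_eq t' t by rewrite perm_sort.
(* The sorted word has letter [tnth t (p i)] at [i], while [word_act] inverts its argument. *)
have t'E : t' = word_act t p^-1%g.
  by apply: val_inj; rewrite /= Ep /word_act /= invgK.
apply/imsetP; exists t'.
  by rewrite inE sorted_map; apply: sort_sorted => x y; apply: leq_total.
by apply/esym/orbit_eqP; rewrite t'E; apply/orbitP; exists p^-1%g.
Qed.

(** Burnside's lemma ([Frobenius_Cauchy]) turns the orbit count into a count of fixed points. *)
Lemma sum_fixed_words n N :
  (\sum_(s : 'S_n) #|[set t : n.-tuple 'I_N.+1 | word_act t s == t]|
    <= 'C(n + N, n) * n`!)%N.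
Proof.
have acts_words :
    [acts [set: 'S_n], on [set: n.-tuple 'I_N.+1] | word_action n 'I_N.+1]%g.
  by apply/subsetP=> s _; rewrite !inE; apply/subsetP=> t _; rewrite !inE.
rewrite (leq_trans _ (leq_mul (card_word_orbits n N) (leqnn _))) //.
rewrite -card_Sn -cardsT -(Frobenius_Cauchy acts_words).
rewrite [leqRHS](eq_bigl xpredT) => [|s]; last by rewrite inE.
apply: leq_sum => s _; apply/subset_leq_card/subsetP=> t.
by rewrite !inE sub1set inE.
Qed.

Lemma leq_binX n N :
  ('C(n + N, n) * (n ^ n * N ^ N) <= (n + N) ^ (n + N))%N.
Proof.
have ltn : (n < (N + n).+1)%N by rewrite ltnS leq_addl.
rewrite (addnC n N) expnDn (bigD1 (Ordinal ltn)) //= addnK (mulnC (n ^ n)%N).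
exact: leq_addr.
Qed.

Section RowWords.

Variables (n : nat) (la : seq nat).

Definition fixed_tabloids (s : 'S_n) : {set tabloid n la} :=
  [set T | (val T :* s)%g == val T].

(** The trace of a permutation matrix counts fixed points. *)
Lemma cfRepr_tabloid s :
  cfRepr (tabloid_repr n la) s = #|fixed_tabloids s|%:R.
Proof.
rewrite cfunE inE /= mulr1n /mxtrace -sum1dep_card natr_sum.
rewrite (reindex (@enum_val (tabloid n la) predT)) /=; last first.
  by apply: onW_bij; apply: enum_val_bij.
rewrite [RHS]big_mkcond.
by apply: eq_bigr => i _; rewrite mxE eq_sym; case: eqP.
Qed.

(** All tableaux in a row class put [x] in the same row, so on a tabloid the choice made by [repr]
    is immaterial. *)
Definition row_word (A : {set 'S_n}) (x : 'I_n) : nat :=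
  entry_row la (repr A) x.

Lemma row_word_class t x : row_word (row_class la t) x = entry_row la t x.
Proof.
have : repr (row_class la t) \in row_class la t.
  by apply: (mem_repr t); rewrite inE; apply/forallP=> y.
by rewrite inE => /forallP/(_ x)/eqP.
Qed.

Lemma row_wordM (T : tabloid n la) s x :
  row_word (val T :* s)%g x = row_word (val T) (s^-1%g x).
Proof.
by have [t ->] := tabloidP T; rewrite /= -row_classM !row_word_class entry_rowM.
Qed.

Lemma row_word_inj (T U : tabloid n la) :
  row_word (val T) =1 row_word (val U) -> T = U.
Proof.
have [t ->] := tabloidP T; have [u ->] := tabloidP U => /= eTU.
apply: val_inj; apply/setP => v; rewrite /= !inE; apply: eq_forallb => x.
by rewrite -!row_word_class eTU.
Qed.

Lemma row_word_lt A x : sumn la = n -> (row_word A x < size la)%N.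
Proof. by move=> Esum; apply: reshape_indexP; rewrite Esum. Qed.

(** [psi] is the character of the quotient by the Specht submodule, since traces add over a
    submodule and its quotient. *)
Lemma Sn_char_tabloid :
  {psi : 'CF([set: 'S_n]) |
     psi \is a character & cfRepr (tabloid_repr n la) = Sn_char n la + psi}.
Proof.
exists (cfRepr (factmod_repr (specht_module n la))); first exact: cfRepr_char.
by apply/cfunP=> s; rewrite !cfunE -mulrnDl -(mxtrace_sub_fact_mod (specht_module n la)).
Qed.

Lemma Sn_char_char : Sn_char n la \is a character.
Proof. exact: cfRepr_char. Qed.

End RowWords.

Lemma leq_fixed_triples n la mu nu N (s : 'S_n) :
    sumn la = n -> sumn mu = n -> sumn nu = n ->
    (size la * size mu * size nu = N)%N ->
  (#|fixed_tabloids la s| * #|fixed_tabloids mu s| * #|fixed_tabloids nu s|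
    <= #|[set t : n.-tuple 'I_N | word_act t s == t]|)%N.
Proof.
move=> hla hmu hnu <-.
pose C := ('I_(size la) * 'I_(size mu) * 'I_(size nu))%type.
have <- : #|{: C}| = (size la * size mu * size nu)%N.
  by rewrite !card_prod !card_ord.
pose c (X : tabloid n la * tabloid n mu * tabloid n nu) x : C :=
  (Ordinal (row_word_lt (val X.1.1) x hla),
   Ordinal (row_word_lt (val X.1.2) x hmu),
   Ordinal (row_word_lt (val X.2) x hnu)).
(* [w] is injective and commutes with S_n, so it sends fixed triples to fixed words. *)
pose w X := [tuple enum_rank (c X i) | i < n].
have w_inj : injective w.
  move=> [[T1 T2] T3] [[U1 U2] U3] eqw.
  have eqc x : c (T1, T2, T3) x = c (U1, U2, U3) x.
    apply: enum_rank_inj.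
    by have := congr1 (fun v : n.-tuple _ => tnth v x) eqw; rewrite !tnth_mktuple.
  by congr (_, _, _); apply: row_word_inj => x; case: (eqc x).
rewrite -!cardsX -(card_imset _ w_inj).
apply/subset_leq_card/subsetP => _ /imsetP[[[T1 T2] T3] fixT ->].
move: fixT; rewrite !inE /= => /andP[/andP[/eqP f1 /eqP f2] /eqP f3].
apply/eqP/eq_from_tnth => x; rewrite !tnth_mktuple; congr enum_rank.
by congr (_, _, _); apply: val_inj; rewrite /= -row_wordM ?f1 ?f2 ?f3.
Qed.

(** As an inner product with the trivial character, the average is nonnegative for characters. *)
Lemma cfdot_Sn1 n (f1 f2 f3 : 'CF([set: 'S_n])) :
  '[f1 * f2 * f3, 1] = (n`!)%:R^-1 * \sum_(s : 'S_n) f1 s * f2 s * f3 s.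
Proof.
rewrite cfdotE cardsT card_Sn; congr (_ * _).
rewrite (eq_bigl xpredT) => [|s]; last by rewrite inE.
apply: eq_bigr => s _; rewrite cfun1E inE conjC_nat mulr1.
by rewrite cfunE [in LHS]cfunE.
Qed.

Lemma kronecker_le_fixed n la mu nu :
  kronecker n la mu nu <= (n`!)%:R^-1 *
    (\sum_(s : 'S_n) #|fixed_tabloids la s| * #|fixed_tabloids mu s| *
                     #|fixed_tabloids nu s|)%N%:R.
Proof.
rewrite natr_sum.
under [X in _ <= _ * X]eq_bigr do rewrite !natrM -!cfRepr_tabloid.
rewrite /kronecker -!cfdot_Sn1.
have [p1 cp1 e1] := Sn_char_tabloid n la.
have [p2 cp2 e2] := Sn_char_tabloid n mu.
have [p3 cp3 e3] := Sn_char_tabloid n nu.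
set f1 := cfRepr _ in e1 *; set f2 := cfRepr _ in e2 *.
set f3 := cfRepr _ in e3 *.
have [c1 c2 c3] : [/\ Sn_char n la \is a character, Sn_char n mu \is a character
    & Sn_char n nu \is a character] by split; apply: Sn_char_char.
set x1 := Sn_char n la in c1 e1 *; set x2 := Sn_char n mu in c2 e2 *.
set x3 := Sn_char n nu in c3 e3 *.
(* Telescoping, one factor replaced at a time: every term of the remainder is a product of
   characters. *)
have -> : f1 * f2 * f3 = x1 * x2 * x3 + (p1 * f2 * f3 + x1 * p2 * f3 + x1 * x2 * p3).
  rewrite !addrA {1}e1 !mulrDl -!addrA [p1 * _ * _ + _]addrC !addrA.
  congr (_ + _); rewrite {1}e2 mulrDr mulrDl {1}e3 mulrDr.
  by rewrite -!addrA [_ * p3 + _]addrC.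
rewrite cfdotDl lerDl; apply/natr_ge0/Cnat_cfdot_char; last exact: cfun1_char.
by rewrite !rpredD ?rpredM // ?cfRepr_char.
Qed.

Theorem theorem5p3 (n l m r : nat) (la mu nu : seq nat)
  (hn : (1 <= n)%N)
  (hla : intpart n la) (hmu : intpart n mu) (hnu : intpart n nu)
  (hl : size la = l) (hm : size mu = m) (hr : size nu = r) :
  kronecker n la mu nu <=
    (1 + (l * m * r)%:R / n%:R) ^+ n *
    (1 + n%:R / (l * m * r)%:R) ^+ (l * m * r).
Proof.
have [/eqP sla /eqP smu /eqP snu] : [/\ sumn la == n, sumn mu == n & sumn nu == n].
  by case/and3P: hla hmu hnu => _ _ -> /and3P[_ _ ->] /and3P[_ _ ->].
have size_gt0 ka : sumn ka = n -> (0 < size ka)%N.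
  by case: ka => // e; rewrite -e in hn.
have : (0 < l * m * r)%N by rewrite !muln_gt0 -hl -hm -hr !size_gt0.
have := leq_fixed_triples _ sla smu snu (erefl _); rewrite hl hm hr.
move: (l * m * r)%N => N fixN N_gt0.
apply: le_trans (kronecker_le_fixed _ _ _ _) _.
apply: (@le_trans _ _ 'C(n + N, n)%:R).
  rewrite mulrC ler_pdivrMr ?ltr0n ?fact_gt0 // -natrM ler_nat.
  apply: leq_trans (leq_sum _ (fun s _ => fixN s)) _.
  (* An alphabet of [N.+1] letters gives ['C(n + N, n)], which is then weakened to
     ['C(n + N.+1, n)]. *)
  case: N N_gt0 {fixN} => // N _; apply: leq_trans (sum_fixed_words n N) _.
  by rewrite leq_mul2r addnS leq_bin2l ?orbT.
have n0 : n%:R != 0 :> algC by rewrite pnatr_eq0 -lt0n.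
have N0 : N%:R != 0 :> algC by rewrite pnatr_eq0 -lt0n.
have -> : 1 + N%:R / n%:R = (n + N)%:R / n%:R :> algC.
  by rewrite natrD mulrDl divff.
have -> : 1 + n%:R / N%:R = (n + N)%:R / N%:R :> algC.
  by rewrite natrD mulrDl divff // addrC.
(* Clearing the common denominator [n ^ n * N ^ N] leaves [leq_binX]. *)
rewrite !expr_div_n mulrACA -exprD -invfM ler_pdivlMr; last first.
  by rewrite -!natrX -natrM ltr0n muln_gt0 !expn_gt0 hn N_gt0.
by rewrite -!natrX -!natrM ler_nat leq_binX.
Qed.
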